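(* Let $\mathcal{H}$ be a real Hilbert space, let $\alpha\in\,]0,+\infty[$, let $W\colon\mathcal{H}\to 2^{\mathcal{H}}$ be maximally monotone, let $C\colon\mathcal{H}\to\mathcal{H}$ be $\alpha$-cocoercive and such that $Z=\mathrm{zer}(W+C)\neq\varnothing$, let $x_0\in\mathcal{H}$, and let $(\lambda_n)_{n\in\mathbb{N}}$ be a sequence in $]0,1]$. Further, for every $n\in\mathbb{N}$, let $U_n\colon\mathcal{H}\to\mathcal{H}$ be an operator such that $\mathrm{ran}\,U_n\subset\mathrm{ran}(U_n+W+C)$ and $U_n+W+C$ is injective. Iterate, for every $n\in\mathbb{N}$, $$w_n=J_{W+C}^{U_n}x_n,\qquad w_n^*=U_nx_n-U_nw_n-Cw_n,\qquad q_n\in\mathcal{H}\ \text{(arbitrary)},\qquad t_n^*=w_n^*+Cq_n,$$ $$\delta_n=\langle x_n-w_n\mid t_n^*\rangle-\frac{\|w_n-q_n\|^2}{4\alpha},\qquad d_n=\begin{cases}\dfrac{\delta_n}{\|t_n^*\|^2}t_n^*,&\text{if }\delta_n>0;\\ 0,&\text{otherwise,}\end{cases}$$ $$r_n=x_n-\lambda_nd_n,\qquad x_{n+1}=\mathsf{Q}(x_0,x_n,r_n).$$ Then the following hold: (i) $\sum_{n\in\mathbb{N}}\lambda_n^2\|d_n\|^2<+\infty$. (ii) Suppose that one of the following is satisfied: (a) $\sum_{n\in\mathbb{N}}\lambda_n^2=+\infty$ and $(\|d_n\|)_{n\in\mathbb{N}}$ converges; (b) $\inf_{n\in\mathbb{N}}\lambda_n>0$;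 together with one of the following: (c) $w_n-x_n\rightharpoonup 0$, $U_nw_n-U_nx_n\to 0$, and $w_n-q_n\to 0$; (d) $q_n-x_n\to 0$ and there exist $\beta_1\in\,]1/(4\alpha),+\infty[$ and $\beta_2\in\,]0,+\infty[$ such that the operators $(U_n)_{n\in\mathbb{N}}$ are $\beta_1$-strongly monotone and $\beta_2$-Lipschitzian. Then $(x_n)_{n\in\mathbb{N}}$ converges strongly to $\mathrm{proj}_Zx_0$.
   Context: For $M\colon\mathcal{H}\to2^{\mathcal{H}}$, $\mathrm{gra}\,M=\{(x,x^* )\mid x^*\in Mx\}$, $\mathrm{ran}\,M=\bigcup_x Mx$, $\mathrm{zer}\,M=\{x\mid 0\in Mx\}$, and $M^{-1}$ is the set-valued inverse. $M$ is injective if $Mx\cap My\neq\varnothing$ implies $x=y$. $M$ is monotone if $\langle x-y\mid x^*-y^*\rangle\ge0$ for all $(x,x^* ),(y,y^* )\in\mathrm{gra}\,M$, maximally monotone if no monotone operator has a graph strictly containing $\mathrm{gra}\,M$, and $\beta$-strongly monotone if $\langle x-y\mid x^*-y^*\rangle\ge\beta\|x-y\|^2$ on its graph. $C$ is $\alpha$-cocoercive if $\langle x-y\mid Cx-Cy\rangle\ge\alpha\|Cx-Cy\|^2$ for all $x,y$. If $\mathrm{ran}\,U\subset\mathrm{ran}(U+M)$ and $U+M$ is injective, the warped resolvent of $M$ with kernel $U\colon\mathcal{H}\to\mathcal{H}$ is the (single-valued, everywhere defined) operator $J_M^U=(U+M)^{-1}\circ U$. $\rightharpoonup$ and $\to$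 denote weak and strong convergence, and $\mathrm{proj}_D$ is the projection operator onto a nonempty closed convex set $D$. For $(x,y)\in\mathcal{H}^2$, $H(x,y)=\{z\in\mathcal{H}\mid\langle z-y\mid x-y\rangle\leq 0\}$; for $(x,y,z)\in\mathcal{H}^3$ such that $H(x,y)\cap H(y,z)\neq\varnothing$, $\mathsf{Q}(x,y,z)$ is the projection of $x$ onto $H(x,y)\cap H(y,z)$. *)

(* Defs.v *)
From HB Require Import structures.
From mathcomp Require Import all_boot all_order all_algebra.
From mathcomp Require Import all_classical all_reals all_analysis.

Set Implicit Arguments.
Unset Strict Implicit.
Unset Printing Implicit Defensive.

Import Order.TTheory GRing.Theory Num.Theory.
Import numFieldNormedType.Exports.

Local Open Scope classical_set_scope.
Local Open Scope ring_scope.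

HB.mixin Record CompleteNormedModule_isHilbert (R : realType) H
    of CompleteNormedModule R H := {
  inner : {dot H for idfun} ;
  inner_norm : forall x : H, inner x x = `|x| ^+ 2
}.

#[short(type="hilbertType")]
HB.structure Definition Hilbert (R : realType) :=
  {H of CompleteNormedModule R H & CompleteNormedModule_isHilbert R H}.

Reserved Notation "''<' x , y >"
  (at level 0, x at level 69, y at level 69, format "''<' x ,  y >").
Notation "''<' x , y >" := (inner x y) : ring_scope.

Section Operators.
Context (R : realType) (H : hilbertType R).

(* A set-valued operator on H is a function H -> set H. *)
Implicit Types M N : H -> set H.
Implicit Types U C : H -> H.

Definition single U : H -> set H := fun x => [set U x].

Definition gra M : set (H * H) := [set p | M p.1 p.2].

Definition ran M : set H := \bigcup_x M x.

Definition zer M : set H := [set x | M x 0].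

Definition op_inv M : H -> set H := fun y => [set x | M x y].

Definition op_add M N : H -> set H :=
  fun x => [set u + v | u in M x & v in N x].

Definition op_injective M := forall x y, M x `&` M y !=set0 -> x = y.

Definition monotone_op M :=
  forall p q, gra M p -> gra M q -> 0 <= '<p.1 - q.1, p.2 - q.2>.

Definition maximally_monotone M :=
  monotone_op M /\ ~ exists N, monotone_op N /\ gra M `<` gra N.

Definition strongly_monotone (beta : R) M :=
  forall p q, gra M p -> gra M q ->
    beta * `|p.1 - q.1| ^+ 2 <= '<p.1 - q.1, p.2 - q.2>.

Definition cocoercive (alpha : R) C :=
  forall x y, alpha * `|C x - C y| ^+ 2 <= '<x - y, C x - C y>.

(* [get] selects the unique element of (U + M)^-1 (U x) when the resolvent
   exists, see [warped_resolventP]; it is an arbitrary point otherwise. *)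
Definition warped_resolvent U M : H -> H :=
  fun x => get (op_inv (op_add (single U) M) (U x)).

Lemma warped_resolventP U M :
  ran (single U) `<=` ran (op_add (single U) M) ->
  op_injective (op_add (single U) M) ->
  forall x, op_inv (op_add (single U) M) (U x) = [set warped_resolvent U M x].
Proof.
move=> ranU inj x.
have /ranU [w _ Mw] : ran (single U) (U x) by exists x.
have Mr : op_inv (op_add (single U) M) (U x) (warped_resolvent U M x).
  exact: (@getI _ (op_inv (op_add (single U) M) (U x)) w).
apply/seteqP; split=> [y My|_ -> //].
by apply: inj; exists (U x).
Qed.

Definition weak_cvg (u : nat -> H) (l : H) :=
  forall y, (fun n => '<u n, y>) @ \oo --> '<l, y>.

(* The nearest point of D to x; an arbitrary point if there is none, which
   does not happen when D is nonempty, closed and convex. *)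
Definition proj_onto (D : set H) (x : H) : H :=
  get [set p | D p /\ forall y, D y -> `|x - p| <= `|x - y|].

Definition halfspace (x y : H) : set H := [set z | '<z - y, x - y> <= 0].

Definition Q (x y z : H) : H := proj_onto (halfspace x y `&` halfspace y z) x.

End Operators.

(* Main.v *)
(** Monotonicity of [W] and cocoercivity of [C] make the halfspace
    [halfspace (x n) (r n)] contain [Z = zer (W + C)], so that the [x n] are
    Haugazeau iterates: [Z] stays in [halfspace x0 (x n)], the distances
    [|x n - x0|] increase and stay below the distance from [x0] to [Z], and
    the increments of their squares dominate [lambda n ^+ 2 * |d n| ^+ 2].

    Weak compactness is avoided. Let [K n] be the intersection of the closed
    halfspaces containing [x m] for all [m >= n]. The projections of [x0] onto
    the decreasing sets [K n] converge strongly to a point [p] of all of them,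
    and [limsup <x n - p, x0 - p> <= 0]. If [p] is in [Z], then
    [|x n - x0| <= |p - x0|] turns this into [x n --> p].

    To get [p] in [Z], only affine inequalities have to pass from the [x n] to [p].
    Comparing [w n] with a zero [z], cocoercivity forces [C (w n) --> C z]
    strongly, hence [wstar n --> - C z]. Maximality of [W] alone then gives
    [W p (- C z)], and cocoercivity gives [C p = C z]. Under (d), the strong
    monotonicity of [U n] bounds [delta n] below by a positive multiple of
    [|w n - x n| ^+ 2], up to terms vanishing with [q n - x n] and [d n], which
    reduces (d) to (c). *)

Require Import Defs.
From mathcomp Require Import all_boot all_order all_algebra.
From mathcomp Require Import all_classical all_reals all_analysis.
From mathcomp Require Import ring lra.

Set Implicit Arguments.
Unset Strict Implicit.
Unset Printing Implicit Defensive.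

Import Order.TTheory GRing.Theory Num.Theory.
Import numFieldNormedType.Exports.

Local Open Scope classical_set_scope.
Local Open Scope ring_scope.

(** * Inner product calculus *)

Section InnerProduct.
Context (R : realType) (H : hilbertType R).
Implicit Types (x y z : H) (a : R).

Lemma innerC x y : '<x, y> = '<y, x>.
Proof. by rewrite hermC expr0 mul1r. Qed.

Lemma innerDl z : {morph (fun x => '<x, z>) : x y / x + y}.
Proof. exact: linearDl. Qed.

Lemma innerDr z : {morph (fun x => '<z, x>) : x y / x + y}.
Proof. exact: linearDr. Qed.

Lemma innerNl z : {morph (fun x => '<x, z>) : x / - x}.
Proof. exact: linearNl. Qed.

Lemma innerNr z : {morph (fun x => '<z, x>) : x / - x}.
Proof. exact: linearNr. Qed.

Lemma innerZl a x y : '<a *: x, y> = a * '<x, y>.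
Proof. exact: linearZl_LR. Qed.

Lemma innerZr a x y : '<x, a *: y> = a * '<x, y>.
Proof. exact: linearZr_LR. Qed.

Lemma inner0l x : '<0, x> = 0.
Proof. exact: linear0l. Qed.

Lemma inner0r x : '<x, 0> = 0.
Proof. exact: linear0r. Qed.

Definition innerE := (innerDl, innerDr, innerNl, innerNr, innerZl, innerZr).

Lemma sqnormD x y : `|x + y| ^+ 2 = `|x| ^+ 2 + 2 * '<x, y> + `|y| ^+ 2.
Proof. by rewrite -!inner_norm !innerE (innerC y x); ring. Qed.

Lemma sqnormB x y : `|x - y| ^+ 2 = `|x| ^+ 2 - 2 * '<x, y> + `|y| ^+ 2.
Proof. by rewrite -!inner_norm !innerE (innerC y x); ring. Qed.

Lemma cauchy_schwarz x y : `|'<x, y>| <= `|x| * `|y|.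
Proof.
have [->|y0] := eqVneq y 0; first by rewrite inner0r !normr0 mulr0.
have y2 : 0 < `|y| ^+ 2 by rewrite exprn_gt0 ?normr_gt0.
have := sqr_ge0 `|(`|y| ^+ 2) *: x - '<x, y> *: y|.
rewrite sqnormB !normrZ !innerE !exprMn ger0_norm ?(ltW y2)// real_normK ?num_real//.
move=> h; rewrite -ler_sqr ?nnegrE ?mulr_ge0// exprMn real_normK ?num_real//.
rewrite -(ler_pM2l y2); lra.
Qed.

End InnerProduct.

(** * Closed convex sets, nearest points and tail hulls *)

Section Convergence.
Context (R : realType) (H : hilbertType R).
Implicit Types (x y z p : H) (u : nat -> H) (D : set H).

(** Polarization expresses the inner product through norms, so continuity of the norm suffices. *)
Lemma cvg_inner T (F : set_system T) (FF : Filter F) (f g : T -> H) x y :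
  f @ F --> x -> g @ F --> y -> '<f t, g t> @[t --> F] --> '<x, y>.
Proof.
have polar a b : '<a, b> = 4^-1 * (`|a + b| * `|a + b| - `|a - b| * `|a - b|) :> R.
  by move=> *; rewrite -!expr2 (sqnormD a b) (sqnormB a b); field.
move=> fx gy; rewrite polar; under eq_fun do rewrite polar.
by apply: cvgMr; apply: cvgB; apply: cvgM; apply: cvg_norm;
  [exact: cvgD|exact: cvgD|exact: cvgB|exact: cvgB].
Qed.

Lemma cvg_inner_bounded T (F : set_system T) (FF : Filter F) (f g : T -> H) M :
  (forall t, `|f t| <= M) -> g @ F --> (0 : H) -> '<f t, g t> @[t --> F] --> (0 : R).
Proof.
move=> fM g0; apply: norm_cvg0; apply: (squeeze_cvgr (f := cst 0)
  (h := fun t => M * `|g t|)); last 2 first.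
- exact: cvg_cst.
- by rewrite -(mulr0 M) -(@normr0 _ H); apply: cvgMr; exact: cvg_norm.
- near=> t; rewrite normr_ge0 (le_trans (cauchy_schwarz _ _))//.
  exact: ler_wpM2r.
Unshelve. all: by end_near. Qed.

Lemma cvgn_of_sqdist u (b : nat -> R) :
  (forall m n, (n <= m)%N -> `|u m - u n| ^+ 2 <= b n) -> b @ \oo --> (0 : R) ->
  cvgn u.
Proof.
move=> ub b0; apply: cauchy_cvg; apply: cauchy_exP => e e0.
have [N _ bN] : \forall n \near \oo, b n < e ^+ 2.
  by apply: cvgr_lt b0 _ _; rewrite exprn_gt0.
exists (u N); exists N => // n /= Nn.
rewrite -ball_normE /= distrC -ltr_sqr ?nnegrE ?(ltW e0)//.
by rewrite (le_lt_trans (ub _ _ Nn)) ?bN/=.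
Qed.

Lemma closed_inner_le y (b : R) : closed [set x | '<x, y> <= b].
Proof.
apply: (@preimage_closed _ _ (fun x => '<x, y>) [set t | t <= b]) => [x _|].
  by apply: cvg_inner; [exact: cvg_id|exact: cvg_cst].
exact: closed_le.
Qed.

(** Convexity, written as a displacement from [x]: the form used to perturb a nearest point. *)
Definition segment_closed D :=
  forall x y (t : R), D x -> D y -> 0 <= t <= 1 -> D (x + t *: (y - x)).

Lemma segment_closed_inner_le y (b : R) : segment_closed [set x | '<x, y> <= b].
Proof. by move=> x z t /= xb zb t01; rewrite !innerE; nra. Qed.

Lemma segment_closedI D E :
  segment_closed D -> segment_closed E -> segment_closed (D `&` E).
Proof. by move=> cD cE x y t [Dx Ex] [Dy Ey] t01; split; [exact: cD|exact: cE]. Qed.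

Lemma segment_closed_bigcap I (P : set I) (D : I -> set H) :
  (forall i, P i -> segment_closed (D i)) -> segment_closed (\bigcap_(i in P) D i).
Proof.
by move=> cD x y t Dx Dy t01 i Pi; apply: (cD _ Pi) => //; [exact: Dx|exact: Dy].
Qed.

Lemma nearest_exists D x : D !=set0 -> closed D -> segment_closed D ->
  exists p, D p /\ forall y, D y -> `|x - p| <= `|x - y|.
Proof.
move=> [y0 Dy0] clD cD; pose S := [set `|x - y| ^+ 2 | y in D]; pose rho := inf S.
have lbS : has_lbound S by exists 0 => _ [y _ <-]; exact: sqr_ge0.
have infS : has_inf S by split => //; exists (`|x - y0| ^+ 2), y0.
have rho_le y : D y -> rho <= `|x - y| ^+ 2 by move=> Dy; apply: ge_inf => //; exists y.
have /choice[u uP] n : exists y, D y /\ `|x - y| ^+ 2 < rho + harmonic n.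
  have h0 : 0 < harmonic n :> R by rewrite invr_gt0 ltr0Sn.
  by have [_ [y Dy <-] yr] := inf_adherent h0 infS; exists y.
have [p up] : exists p, u @ \oo --> p.
  apply/cvg_ex/(@cvgn_of_sqdist _ (fun n => 4 * harmonic n)); last first.
    by rewrite -(mulr0 4); apply: cvgMr; exact: cvg_harmonic.
  move=> m n nm; have [Dm um] := uP m; have [Dn un] := uP n.
  have hmn : harmonic m <= harmonic n :> R by rewrite lef_pV2 ?posrE// ler_nat ltnS.
  (* The midpoint of [u m] and [u n] stays in [D], so its squared distance to [x] is at least [rho];
     the parallelogram law then bounds [|u m - u n|^2] by [2 (harmonic m + harmonic n)]. *)
  have h01 : 0 <= (2^-1 : R) <= 1 by lra.
  have := rho_le _ (cD _ _ _ Dm Dn h01).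
  have -> : x - (u m + 2^-1 *: (u n - u m)) = (x - u m) - 2^-1 *: ((x - u m) - (x - u n)).
    by rewrite opprD addrA opprB [x - u m + (u n - x)]addrC subrKA.
  have -> : u m - u n = (x - u n) - (x - u m).
    by rewrite opprB [RHS]addrC subrKA.
  move: um un; set a := x - u m; set b := x - u n => um un; clearbody a b.
  rewrite (sqnormB a) normrZ exprMn !innerE inner_norm (sqnormB a) (sqnormB b).
  rewrite ger0_norm ?invr_ge0//.
  rewrite (innerC b). lra.
exists p; split; first by apply: (closed_cvg _ clD _ _ up); near=> n; have [] := uP n.
move=> y Dy; rewrite -ler_sqr ?nnegrE//; apply: le_trans (rho_le _ Dy).
have xu : `|x - u n| ^+ 2 @[n --> \oo] --> `|x - p| ^+ 2.
  by apply: cvgM; apply: cvg_norm; apply: cvgB => //; exact: cvg_cst.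
have rh : rho + harmonic n @[n --> \oo] --> rho.
  by rewrite -[X in _ --> X]addr0; apply: cvgD; [exact: cvg_cst|exact: cvg_harmonic].
by apply: (ler_cvg_to xu rh); near=> n; have [_ /ltW] := uP n.
Unshelve. all: by end_near. Qed.

Lemma nearest_inner_le D x p y : segment_closed D -> D p ->
  (forall y, D y -> `|x - p| <= `|x - y|) -> D y -> '<y - p, x - p> <= 0.
Proof.
move=> cD Dp min Dy; rewrite leNgt; apply/negP => gt0.
set s := '<_, _> in gt0; set q := `|y - p| ^+ 2.
have q0 : 0 <= q by exact: sqr_ge0.
(* Moving from [p] towards [y] by [t] changes the squared distance by [t^2 q - 2 t s]. This choice
   gives [t <= 1] and [t q <= s], so the change is negative. *)
pose t := s / (s + q).
have t01 : 0 <= t <= 1 by rewrite divr_ge0 ?addr_ge0 ?(ltW gt0)//= ler_pdivrMr; lra.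
have := min _ (cD _ _ _ Dp Dy t01); rewrite -ler_sqr ?nnegrE//.
rewrite opprD addrA (sqnormB (x - p)).
rewrite innerZr normrZ exprMn real_normK ?num_real// (innerC (x - p)) -/s -/q.
have -> : 2 * (t * s) = (2 * s) * t by ring.
have ts : t * (s + q) = s by rewrite divfK//; lra.
have tgt0 : 0 < t by rewrite divr_gt0//; lra.
by nra.
Qed.

(* [p] lies in the closed convex hull of every tail of [u]. *)
Definition in_tail_hulls u p :=
  forall y b, (\forall n \near \oo, '<u n, y> <= b) -> '<p, y> <= b.

(** Stands in for a weak cluster point of [u]: [p] is the limit of the projections [v n] of [x] onto
    the closed convex hulls [K n] of the tails, and the second clause is the limit form of
    [<u n - v n, x - v n> <= 0]. *)
Lemma asymptotic_projection u (M : R) x : (forall n, `|u n| <= M) ->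
  exists p,
    in_tail_hulls u p /\
    (forall e, 0 < e -> \forall n \near \oo, '<u n - p, x - p> <= e).
Proof.
move=> uM; pose tail n := [set yb : H * R | forall m, (n <= m)%N -> '<u m, yb.1> <= yb.2].
pose K n := \bigcap_(yb in tail n) [set z | '<z, yb.1> <= yb.2].
have Ku n m : (n <= m)%N -> K n (u m) by move=> nm [y b]; exact.
have clK n : closed (K n) by apply: closed_bigI => ? _; exact: closed_inner_le.
have cK n : segment_closed (K n).
  by apply: segment_closed_bigcap => ? _; exact: segment_closed_inner_le.
have KS n m z : (n <= m)%N -> K m z -> K n z.
  by move=> nm Kz [y b] yb; apply: (Kz (y, b)) => k mk; apply: yb; exact: leq_trans mk.
have /choice[v vP] n := nearest_exists x (ex_intro _ _ (Ku _ _ (leqnn n))) (clK n) (cK n).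
have Kv n : K n (v n) by have [] := vP n.
have vmin n y : K n y -> `|x - v n| <= `|x - y| by have [_] := vP n; exact.
have vvar n y : K n y -> '<y - v n, x - v n> <= 0.
  exact: (nearest_inner_le (cK n) (Kv n) (vmin n)).
pose a n := `|x - v n| ^+ 2.
have aM n : a n <= (`|x| + M) ^+ 2.
  rewrite ler_sqr ?nnegrE ?addr_ge0 ?(le_trans _ (uM 0%N))//.
  rewrite (le_trans (vmin _ _ (Ku _ _ (leqnn n))))//.
  by rewrite (le_trans (ler_normB _ _))// lerD2l.
(* As [v m] lies in [K n], the variational inequality at [v n] bounds [|v m - v n|^2] by an
   increment of the bounded nondecreasing sequence [a]; hence [v] is Cauchy. *)
have vdist m n : (n <= m)%N -> `|v m - v n| ^+ 2 <= a m - a n.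
  move=> nm; have := vvar n _ (KS _ _ _ nm (Kv m)).
  rewrite /a; have -> : x - v m = (x - v n) - (v m - v n) by rewrite opprB addrA subrK.
  by rewrite (sqnormB (x - v n)) (innerC (x - v n)); lra.
have a_nd : nondecreasing_seq a.
  by move=> n m /vdist; have := sqr_ge0 `|v m - v n|; lra.
have aub : has_ubound (range a) by exists ((`|x| + M) ^+ 2) => _ [n _ <-].
have [p vp] : exists p, v @ \oo --> p.
  apply/cvg_ex/(@cvgn_of_sqdist _ (fun n => sup (range a) - a n)).
    move=> m n /vdist/le_trans; apply; rewrite lerD2r.
    by apply: ub_le_sup => //; exists m.
  rewrite -(subrr (sup (range a))); apply: cvgB; first exact: cvg_cst.
  exact: nondecreasing_cvgn.
have Kp n : K n p.
  by apply: (closed_cvg _ (clK n) _ _ vp); exists n => // m /= nm; exact: KS (Kv m).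
exists p; split=> [y b [n _ nb]|e e0]; first by apply: (Kp n (y, b)) => m; exact: nb.
(* This bounds the error made when [v n] is replaced by [p] in [<u n - v n, x - v n>]. *)
have : '<v n - p, x - v n> + (`|p| + M) * `|p - v n| @[n --> \oo] --> (0 : R).
  rewrite -[X in _ --> X]addr0; apply: cvgD.
    rewrite -(inner0l (x - p)); apply: cvg_inner.
      by rewrite -(subrr p); apply: cvgB => //; exact: cvg_cst.
    by apply: cvgB => //; exact: cvg_cst.
  rewrite -(mulr0 (`|p| + M)); apply: cvgMr; rewrite -(@normr0 _ H); apply: cvg_norm.
  by rewrite -(subrr p); apply: cvgB => //; exact: cvg_cst.
move=> /cvgr_le/(_ e e0); apply: filterS => n; apply: le_trans.
have -> : u n - p = (u n - v n) + (v n - p) by rewrite addrA subrK.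
have -> : '<u n - v n + (v n - p), x - p> =
  '<u n - v n, x - v n> + '<v n - p, x - v n> - '<u n - p, p - v n>.
  by rewrite !innerE; ring.
have := vvar n _ (Ku n n (leqnn n)).
have : - '<u n - p, p - v n> <= (`|p| + M) * `|p - v n|; last by lra.
rewrite (le_trans (ler_norm _))// normrN (le_trans (cauchy_schwarz _ _))//.
by rewrite ler_wpM2r// (le_trans (ler_normB _ _))// addrC lerD2l.
Qed.

End Convergence.

(** * Weak convergence and its effect on tail hulls *)

Section Weak.
Context (R : realType) (H : hilbertType R).
Implicit Types (x y z p : H) (u : nat -> H).

(** Uniform boundedness principle for the functionals [<u n, .>]; their bound on the unit ball,
    taken at the normalized [u n], is a bound on the norm. *)
Lemma weak_cvg_bounded u l : weak_cvg u l -> exists M, forall n, `|u n| <= M.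
Proof.
move=> ul; pose F : set (H -> R^o) := range (fun n y => '<u n, y>).
have linF f : F f -> bounded_fun_norm f /\ linear f.
  move=> [n _ <-]; split; last by move=> a x y; rewrite !innerE.
  move=> s; exists (`|u n| * s) => x xs.
  by rewrite (le_trans (cauchy_schwarz _ _))// ler_wpM2l.
have ptF : pointwise_bounded F.
  move=> y; have /cvgP/cvg_seq_bounded[M [_ /(_ (M + 1))]] := ul y.
  rewrite ltrDl ltr01 => /(_ isT) uM.
  by exists (M + 1) => _ [n _ <-]; exact: (uM n).
have [M MP] := Banach_Steinhauss linF ptF 1.
have uM n y : `|y| <= 1 -> `|'<u n, y>| <= M by apply: MP; exists n.
exists M => n; have [->|u0] := eqVneq (u n) 0.
  by have := uM n 0; rewrite inner0r !normr0 ler01; exact.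
have nu0 : `|u n| != 0 by rewrite normr_eq0.
have := uM n (`|u n|^-1 *: u n).
rewrite normrZ normfV normr_id mulVf// lexx innerZr inner_norm expr2 mulKf//.
by rewrite normr_id; exact.
Qed.

Lemma in_tail_hulls_cvg u p y (f : nat -> R) l :
  in_tail_hulls u p -> f @ \oo --> l -> (forall n, '<u n, y> <= f n) -> '<p, y> <= l.
Proof.
move=> up fl uf; apply/ler_addgt0Pr => e e0; apply: up.
have : l < l + e by rewrite ltrDl.
by move=> /(cvgr_le l fl); apply: filterS => n; exact: le_trans.
Qed.

(** Tail hulls are tested one direction [y] at a time, so a weakly null perturbation costs only an
    arbitrarily small slack. *)
Lemma in_tail_hulls_weak u v p :
  weak_cvg (fun n => v n - u n) 0 -> in_tail_hulls u p -> in_tail_hulls v p.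
Proof.
move=> vu up y b vb; apply/ler_addgt0Pr => e e0; apply: up.
have := vu y; rewrite inner0l => /cvgr_ge; move=> /(_ (- e)); rewrite oppr_lt0 => /(_ e0).
by apply: filterS2 vb => n; rewrite innerDl innerNl; lra.
Qed.

Lemma cvg_weak u l : u @ \oo --> l -> weak_cvg u l.
Proof. by move=> ul y; apply: cvg_inner => //; exact: cvg_cst. Qed.

End Weak.

(** * Haugazeau's scheme *)

Section Haugazeau.
Context (R : realType) (H : hilbertType R).
Implicit Types (x y z p : H) (u : nat -> H) (Z : set H).

Lemma halfspaceE x y : halfspace x y = [set z | '<z, x - y> <= '<y, x - y> ].
Proof.
by apply/seteqP; split=> z; rewrite /halfspace/= innerDl innerNl subr_le0.
Qed.

(** The angle at [y] between [x] and [z] is at least a right angle, so Pythagoras becomes an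
    inequality. *)
Lemma halfspace_sqdist x y z :
  halfspace x y z -> `|z - y| ^+ 2 <= `|z - x| ^+ 2 - `|x - y| ^+ 2.
Proof.
rewrite /halfspace/= => h; have -> : z - x = (z - y) - (x - y).
  by rewrite opprB subrKA.
by rewrite (sqnormB (z - y)); lra.
Qed.

Lemma closed_halfspace x y : closed (halfspace x y).
Proof. by rewrite halfspaceE; exact: closed_inner_le. Qed.

Lemma segment_closed_halfspace x y : segment_closed (halfspace x y).
Proof. by rewrite halfspaceE; exact: segment_closed_inner_le. Qed.

(** The second clause is the variational inequality for the projection of [x]; it is what carries
    [Z] through the induction on the iterates. *)
Lemma Q_spec x y z : halfspace x y `&` halfspace y z !=set0 ->
  (halfspace x y `&` halfspace y z) (Q x y z) /\
  halfspace x y `&` halfspace y z `<=` halfspace x (Q x y z).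
Proof.
set D := _ `&` _ => D0.
have cD : segment_closed D by apply: segment_closedI; exact: segment_closed_halfspace.
have clD : closed D by apply: closedI; exact: closed_halfspace.
have [p pP] := nearest_exists x D0 clD cD.
have [DQ Qmin] := @getI _ [set p | D p /\ forall y, D y -> `|x - p| <= `|x - y|] _ pP.
by split=> // v; exact: nearest_inner_le.
Qed.

Lemma haugazeau_cvg Z x0 u : Z !=set0 -> (forall n, Z `<=` halfspace x0 (u n)) ->
  (forall p, in_tail_hulls u p -> Z p) -> u @ \oo --> proj_onto Z x0.
Proof.
move=> [z0 Zz0] Zu hullZ.
have uZ z n : Z z -> `|u n - x0| <= `|x0 - z|.
  move=> /(Zu n)/halfspace_sqdist; rewrite (distrC z x0) (distrC x0 (u n)).
  by move=> h; rewrite -ler_sqr ?nnegrE//; have := sqr_ge0 `|z - u n|; lra.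
have uM n : `|u n| <= `|x0| + `|x0 - z0|.
  by rewrite -{1}(subrK x0 (u n)) addrC (le_trans (ler_normD _ _))// lerD2l uZ.
have [p [/hullZ Zp pe]] := asymptotic_projection x0 uM.
have up : u @ \oo --> p.
  apply/subr_cvg0/cvgr0Pnorm_lt => e e0.
  (* Since [|u n - x0| <= |x0 - p|], expanding at [p] gives [|u n - p|^2 <= 2 <u n - p, x0 - p>], at
     most [2 e^2 / 3]. *)
  have /pe : 0 < e ^+ 2 / 3 by rewrite divr_gt0 ?exprn_gt0.
  apply: filterS => n; rewrite -ltr_sqr ?nnegrE ?(ltW e0)//.
  have := uZ _ n Zp; rewrite -[_ <= `|x0 - p|]ler_sqr ?nnegrE//.
  have -> : u n - x0 = (u n - p) - (x0 - p) by rewrite opprB subrKA.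
  rewrite (sqnormB (u n - p)); have : 0 < e ^+ 2 by rewrite exprn_gt0.
  lra.
have pmin z : Z z -> `|x0 - p| <= `|x0 - z|.
  move=> Zz; rewrite distrC; apply: (@cvgr_to_le _ \oo _ _ (fun n => `|u n - x0|)).
    by apply: cvg_norm; apply: cvgB => //; exact: cvg_cst.
  by apply: nearW => n; exact: uZ.
have [] := @getI _ [set p | Z p /\ forall y, Z y -> `|x0 - p| <= `|x0 - y|]
  p (conj Zp pmin).
(* Both [p] and [q] are nearest points. As [q] lies in every [halfspace x0 (u n)], the limit gives
   [|q - p|^2 <= |q - x0|^2 - |x0 - p|^2 <= 0]. *)
rewrite -/(proj_onto Z x0); set q := proj_onto Z x0 => Zq /(_ _ Zp) qp.
suff -> : q = p by [].
apply/eqP; rewrite -subr_eq0 -normr_eq0 -sqrf_eq0 eq_le sqr_ge0 andbT.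
apply: (@le_trans _ _ (`|q - x0| ^+ 2 - `|x0 - p| ^+ 2)); last first.
  by rewrite (distrC q) subr_le0 ler_sqr ?nnegrE.
have cl : `|q - u n| ^+ 2 @[n --> \oo] --> `|q - p| ^+ 2.
  by apply: cvgM; apply: cvg_norm; apply: cvgB => //; exact: cvg_cst.
have cr : `|q - x0| ^+ 2 - `|x0 - u n| ^+ 2 @[n --> \oo] -->
    `|q - x0| ^+ 2 - `|x0 - p| ^+ 2.
  apply: cvgB; first exact: cvg_cst.
  by apply: cvgM; apply: cvg_norm; apply: cvgB => //; exact: cvg_cst.
by apply: (ler_cvg_to cl cr); apply: nearW => n; exact/halfspace_sqdist/Zu.
Qed.

(** A point of [Z] in both halfspaces makes each [Q] a genuine projection. Applying
    [halfspace_sqdist] to each of the two halfspaces gives [|u n - r n|^2 <= |u n.+1 - x0|^2 - |u n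
    - x0|^2], which telescopes. *)
Lemma haugazeau_iterates Z x0 u (r : nat -> H) : Z !=set0 -> u 0%N = x0 ->
  (forall n, u n.+1 = Q x0 (u n) (r n)) -> (forall n, Z `<=` halfspace (u n) (r n)) ->
  forall n, Z `<=` halfspace x0 (u n) /\
    \sum_(0 <= i < n) `|u i - r i| ^+ 2 <= `|u n - x0| ^+ 2.
Proof.
move=> Z0 u0 uS Zr; elim=> [|n [Zn sumn]].
  by split=> [z _|]; rewrite ?big_nil ?sqr_ge0// u0 /halfspace/= subrr inner0r.
have [|[Dl Dr] DQ] := @Q_spec x0 (u n) (r n).
  by have [z Zz] := Z0; exists z; split; [exact: Zn|exact: Zr].
rewrite uS; split; first by move=> z Zz; apply: DQ; split; [exact: Zn|exact: Zr].
rewrite big_nat_recr//=.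
move: Dl Dr => /halfspace_sqdist + /halfspace_sqdist.
rewrite (distrC x0 (u n)).
by have := sqr_ge0 `|Q x0 (u n) (r n) - r n|; lra.
Qed.

End Haugazeau.

(** * Real sequences forced to vanish *)

Section RealSequences.
Context (R : realType).
Implicit Types (a b l d : nat -> R).

(** Completing the square turns the hypothesis into [k^2 a^2 <= b^2 + 2 k c]. *)
Lemma cvg0_of_quadratic (k : R) a b c : 0 < k ->
  (forall n, k * a n ^+ 2 <= a n * b n + c n) ->
  b @ \oo --> (0 : R) -> c @ \oo --> (0 : R) -> a @ \oo --> (0 : R).
Proof.
move=> k0 abc b0 c0; apply/cvgr0Pnorm_lt => e e0.
have lim0 : b n * b n + 2 * k * c n @[n --> \oo] --> (0 : R).
  rewrite -[X in _ --> X]addr0; apply: cvgD.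
    by rewrite -(mulr0 0); exact: cvgM.
  by rewrite -(mulr0 (2 * k)); exact: cvgMr.
have ke : 0 < k ^+ 2 * e ^+ 2 by rewrite mulr_gt0 ?exprn_gt0.
have [N _ Nlt] := cvgr_lt _ lim0 _ ke; exists N => // n /Nlt /=.
move=> h; rewrite -ltr_sqr ?nnegrE ?(ltW e0)// real_normK ?num_real//.
rewrite -(ltr_pM2l (exprn_gt0 2 k0)); apply: le_lt_trans h.
have := sqr_ge0 (k * a n - b n).
have : k * (k * a n ^+ 2) <= k * (a n * b n + c n) by rewrite ler_wpM2l ?(ltW k0).
by lra.
Qed.

Lemma cvg0_of_sum_bounded a B : (forall n, 0 <= a n) ->
  (forall n, \sum_(0 <= i < n) a i <= B) -> a @ \oo --> (0 : R).
Proof.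
move=> a0 aB; apply: cvg_series_cvg_0; apply: nondecreasing_is_cvgn.
  by apply/nondecreasing_seqP => n; rewrite /series/= big_nat_recr//= lerDl.
by exists B => _ [n _ <-]; exact: aB.
Qed.

Lemma nneseries_le a B : (forall n, 0 <= a n) ->
  (forall n, \sum_(0 <= i < n) a i <= B) ->
  (\sum_(0 <= n <oo) (a n)%:E <= B%:E)%E.
Proof.
move=> a0 aB; apply: lime_le; first by apply: is_cvg_nneseries => n _ _; rewrite lee_fin.
by apply: nearW => n; rewrite sumEFin lee_fin.
Qed.

(** A limit [m > 0] would keep [d n] above [m / 2] from some [N] on, and then the weighted bound [B]
    would make the sum of [l n ^ 2] finite. *)
Lemma cvg0_of_weights l d B : (forall n, 0 <= d n) ->
  (forall n, \sum_(0 <= i < n) l i ^+ 2 * d i ^+ 2 <= B) ->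
  ((\sum_(0 <= n <oo) (l n ^+ 2)%:E = +oo)%E /\ cvgn d) -> d @ \oo --> (0 : R).
Proof.
move=> d0 ldB [lsum /cvg_ex[m dm]]; suff <- : m = 0 by [].
have m0 : 0 <= m by apply: (cvgr_to_ge dm); exact: nearW.
apply/eqP; rewrite eq_le m0 andbT leNgt; apply/negP => mgt0.
have [N _ Nd] : \forall n \near \oo, m / 2 <= d n.
  by apply: cvgr_ge dm _ _; rewrite ltr_pdivrMr// ltr_pMr// ltr1n.
pose c := (m / 2) ^+ 2; have c0 : 0 < c by rewrite exprn_gt0// divr_gt0.
have tail k : \sum_(0 <= i < N + k) l i ^+ 2 <= \sum_(0 <= i < N) l i ^+ 2 +
    c^-1 * \sum_(0 <= i < N + k) l i ^+ 2 * d i ^+ 2.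
  elim: k => [|k IH].
    rewrite addn0 lerDl mulr_ge0 ?invr_ge0 ?(ltW c0)//.
    by apply: sumr_ge0 => i _; rewrite mulr_ge0 ?sqr_ge0.
  rewrite addnS !big_nat_recr//= mulrDr addrA; apply: lerD => //.
  have ck : c <= d (N + k)%N ^+ 2.
    by rewrite ler_sqr ?nnegrE ?divr_ge0 ?(ltW mgt0)// Nd//= leq_addr.
  by rewrite mulrCA ler_peMr ?sqr_ge0// ler_pdivlMl// mulr1.
have := @nneseries_le (fun n => l n ^+ 2) (\sum_(0 <= i < N) l i ^+ 2 + c^-1 * B).
rewrite lsum leye_eq => h.
suff : ((\sum_(0 <= i < N) l i ^+ 2 + c^-1 * B)%:E == +oo)%E by [].
apply: h => n; first exact: sqr_ge0.
apply: (@le_trans _ _ (\sum_(0 <= i < N + n) l i ^+ 2)).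
  rewrite addnC [leRHS](@big_cat_nat _ _ _ n)//= ?leq_addr// lerDl.
  by apply: sumr_ge0 => i _; exact: sqr_ge0.
by rewrite (le_trans (tail n))// lerD2l ler_wpM2l ?invr_ge0 ?(ltW c0).
Qed.

Lemma cvg0_of_inf_weights l d B : (forall n, 0 < l n) -> 0 < inf (range l) ->
  (forall n, \sum_(0 <= i < n) l i ^+ 2 * d i ^+ 2 <= B) -> d @ \oo --> (0 : R).
Proof.
move=> l0 m0 ldB; set m := inf _ in m0.
have ml n : m <= l n.
  by apply: ge_inf; [exists 0 => _ [k _ <-]; exact: ltW|exists n].
have ld0 n : 0 <= l n ^+ 2 * d n ^+ 2 by rewrite mulr_ge0 ?sqr_ge0.
apply: (@cvg0_of_quadratic (m ^+ 2) _ (cst 0) (fun n => l n ^+ 2 * d n ^+ 2)).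
- exact: exprn_gt0.
- move=> n; rewrite mulr0 add0r ler_wpM2r ?sqr_ge0//.
  by rewrite ler_sqr ?nnegrE ?(ltW m0) ?(ltW (l0 n)).
- exact: cvg_cst.
- exact: cvg0_of_sum_bounded ldB.
Qed.

End RealSequences.

(** * Monotone operators and cocoercivity *)

Section MonotoneOperators.
Context (R : realType) (H : hilbertType R).
Implicit Types (x y z p q w : H) (u : nat -> H) (W : H -> set H) (C U : H -> H).

(** Adjoining [(p, ps)] to the graph preserves monotonicity, so maximality forces it to be there
    already. *)
Lemma maximally_monotone_mem W p ps : maximally_monotone W ->
  (forall y ys, W y ys -> 0 <= '<p - y, ps - ys>) -> W p ps.
Proof.
move=> [monW maxW] pW; apply: contrapT => Wp; apply: maxW.
exists (fun x => W x `|` [set ps' | x = p /\ ps' = ps]); split.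
  move=> [x xs] [y ys] [/= Wx|/= [-> ->]] [/= Wy|/= [-> ->]].
  - exact: (monW (x, xs) (y, ys)).
  - by rewrite -opprB -(opprB ps) innerNl innerNr opprK; exact: pW.
  - exact: pW.
  - by rewrite subrr inner0l.
split=> [[x xs] Wx|]; first by left.
by move=> /(_ (p, ps)) h; apply/Wp/h; right.
Qed.

Lemma zer_add_single W C z : zer (op_add W (single C)) z <-> W z (- C z).
Proof.
split=> [[a Wa [_ ->]] /eqP|Wz].
  by rewrite addr_eq0 => /eqP <-.
by exists (- C z) => //; exists (C z) => //; rewrite addNr.
Qed.

Lemma warped_resolvent_mem U W C x :
  ran (single U) `<=` ran (op_add (single U) (op_add W (single C))) ->
  op_injective (op_add (single U) (op_add W (single C))) ->
  let w := warped_resolvent U (op_add W (single C)) x in W w (U x - U w - C w).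
Proof.
move=> ranU inj /=; set w := warped_resolvent _ _ _.
have : op_inv (op_add (single U) (op_add W (single C))) (U x) w.
  by rewrite (warped_resolventP ranU inj).
move=> [_ -> [_ [a Wa [_ -> <-]] <-]].
by rewrite [U w + _]addrC addrK addrK.
Qed.

Lemma cocoercive_lipschitz alpha C x y : cocoercive alpha C ->
  alpha * `|C x - C y| <= `|x - y|.
Proof.
move=> coC; have [->|n0] := eqVneq (C x - C y) 0; first by rewrite normr0 mulr0.
rewrite -(@ler_pM2r _ `|C x - C y|) ?normr_gt0// -mulrA -expr2.
by rewrite (le_trans (coC x y))// (le_trans (ler_norm _))// cauchy_schwarz.
Qed.

(** Monotonicity controls [<w - z, ws + C z>] and cocoercivity controls [<q - z, v>]. The right-hand
    side is the price of evaluating [C] at [q] instead of [w]. *)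
Lemma zer_separation alpha W C z w ws q : 0 < alpha -> monotone_op W ->
  cocoercive alpha C -> W z (- C z) -> W w ws ->
  '<z - w, ws + C q> <= `|w - q| ^+ 2 / (4 * alpha).
Proof.
move=> alpha0 monW coC Wz Ww.
have := monW (w, ws) (z, - C z) Ww Wz; rewrite /= opprK.
have := coC q z; set v := C q - C z.
have -> : ws + C q = (ws + C z) + v
  by rewrite /v -addrA; congr (_ + _); rewrite addrC subrK.
have -> : '<z - w, ws + C z + v> = - '<w - z, ws + C z> - '<q - z, v> - '<w - q, v>.
  by rewrite !innerE; ring.
(* AM-GM: [- <w - q, v> <= |w - q|^2 / (4 alpha) + alpha |v|^2] *)
have : 0 <= `|w - q + (2 * alpha) *: v| ^+ 2 / (4 * alpha).
  by rewrite divr_ge0 ?sqr_ge0// mulr_ge0// ltW.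
rewrite sqnormD normrZ innerZr exprMn ger0_norm; last by rewrite mulr_ge0// ltW.
have -> : (`|w - q| ^+ 2 + 2 * (2 * alpha * '<w - q, v>) + (2 * alpha) ^+ 2 * `|v| ^+ 2) /
  (4 * alpha) = `|w - q| ^+ 2 / (4 * alpha) + '<w - q, v> + alpha * `|v| ^+ 2.
  by field; rewrite gt_eqF.
lra.
Qed.

(* Plays the role of the demiclosedness principle for [W + C] at 0. *)
Lemma zer_of_in_tail_hulls alpha W C u (e : nat -> H) z p M : 0 < alpha ->
  maximally_monotone W -> cocoercive alpha C -> W z (- C z) ->
  (forall n, W (u n) (e n - C (u n))) -> e @ \oo --> (0 : H) ->
  (forall n, `|u n| <= M) -> in_tail_hulls u p -> W p (- C p).
Proof.
move=> alpha0 maxW coC Wz We e0 uM up.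
have ubnd (y : H) n : `|u n - y| <= M + `|y|.
  by rewrite (le_trans (ler_normB _ _))// lerD2r.
(* Monotonicity and cocoercivity add up to [alpha |C (u n) - C z|^2 <= <u n - z, e n>]. *)
have Cu0 : C (u n) - C z @[n --> \oo] --> (0 : H).
  apply: norm_cvg0; apply: (@cvg0_of_quadratic _ alpha _ (cst 0)
    (fun n => '<u n - z, e n>)) => //; last 2 first.
  - exact: cvg_cst.
  - by apply: cvg_inner_bounded (ubnd z) e0.
  move=> n; rewrite mulr0 add0r.
  have := maxW.1 (u n, e n - C (u n)) (z, - C z) (We n) Wz.
  have -> : '<u n - z, e n - C (u n) - - C z> =
      '<u n - z, e n> - '<u n - z, C (u n) - C z> by rewrite !innerE; ring.
  by have := coC (u n) z; lra.
have Cp : C p = C z.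
  apply/eqP; rewrite -subr_eq0 -normr_eq0 -sqrf_eq0 eq_le sqr_ge0 andbT.
  set v := C p - C z.
  (* Cocoercivity between [p] and [u n] reads [<u n, v> <= f n], affine in [u n] up to convergent
     terms. In the limit [alpha |v|^2 <= 0]. *)
  pose f n := '<p, v> + '<u n - p, C (u n) - C z> - alpha * `|v - (C (u n) - C z)| ^+ 2.
  have fl : f @ \oo --> '<p, v> - alpha * `|v| ^+ 2.
    apply: cvgB.
      rewrite -[X in _ --> X]addr0; apply: cvgD; first exact: cvg_cst.
      by apply: cvg_inner_bounded (ubnd p) Cu0.
    apply: cvgMr; have {2}-> : v = v - 0 by rewrite subr0.
    by apply: cvgM; apply: cvg_norm; apply: cvgB => //; exact: cvg_cst.
  have := in_tail_hulls_cvg up fl => /(_ v) h.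
  suff : '<p, v> <= '<p, v> - alpha * `|v| ^+ 2.
    by rewrite lerBrDr gerDl pmulr_rle0.
  apply: h => n; rewrite /f.
  have -> : v - (C (u n) - C z) = C p - C (u n).
    by rewrite /v opprB addrA subrK.
  have := coC p (u n).
  have -> : C p - C (u n) = v - (C (u n) - C z) by rewrite /v opprB addrA subrK.
  by rewrite !(innerDl, innerNl, innerDr, innerNr); lra.
rewrite Cp; apply: maximally_monotone_mem => // y ys Wy.
have -> : '<p - y, - C z - ys> = '<y, ys + C z> - '<p, ys + C z>.
  by rewrite !innerE; ring.
(* Monotonicity between [u n] and [y] in affine form: the remaining term pairs a bounded sequence
   with a strongly null one. *)
rewrite subr_ge0; apply: (in_tail_hulls_cvg up (f := fun n =>
    '<y, ys + C z> + '<u n - y, e n - (C (u n) - C z)>)).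
  rewrite -[X in _ --> X]addr0; apply: cvgD; first exact: cvg_cst.
  apply: cvg_inner_bounded (ubnd y) _.
  by rewrite -(subr0 0); exact: cvgB.
move=> n; have := maxW.1 (u n, e n - C (u n)) (y, ys) (We n) Wy => /=.
by rewrite !innerE; lra.
Qed.

End MonotoneOperators.

(** * Geometry of a single relaxed step *)

Section Step.
Context (R : realType) (H : hilbertType R).
Implicit Types (x y z p q w t d : H) (C U : H -> H) (delta lambda : R).

(** The first hypothesis rules out [t = 0] when [0 < delta], so the quotient is never a division by
    zero. *)
Lemma step_norm delta t d : (t = 0 -> delta <= 0) ->
  d = (if 0 < delta then (delta / `|t| ^+ 2) *: t else 0) ->
  delta <= `|d| * `|t|.
Proof.
move=> t0 ->; case: ltP => [d0|dle0]; last by rewrite normr0 mul0r.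
have tn0 : `|t| != 0.
  by rewrite normr_eq0; apply/eqP => /t0; rewrite leNgt d0.
rewrite normrZ ger0_norm; last by rewrite divr_ge0 ?(ltW d0)// sqr_ge0.
suff -> : delta / `|t| ^+ 2 * `|t| * `|t| = delta by [].
by field.
Qed.

(** For [0 < delta], [x - d] is the projection of [x] onto the cut [<z - x, t> <= - delta]; relaxing
    by [lambda <= 1] stops short of it, so the new halfspace contains the cut. *)
Lemma step_halfspace delta lambda x t d z : (t = 0 -> delta <= 0) ->
  d = (if 0 < delta then (delta / `|t| ^+ 2) *: t else 0) ->
  0 < lambda <= 1 -> '<z - x, t> <= - delta -> halfspace x (x - lambda *: d) z.
Proof.
move=> t0 -> /andP[l0 l1] zx; rewrite /halfspace/= !opprB addrA addrAC.
rewrite [x + _]addrC subrK.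
case: ltP => [d0|_]; last by rewrite !scaler0 inner0r.
have tn0 : `|t| != 0.
  by rewrite normr_eq0; apply/eqP => /t0; rewrite leNgt d0.
set c := delta / _; have c0 : 0 < c.
  by rewrite divr_gt0// exprn_gt0// lt_def tn0 normr_ge0.
rewrite !innerZr pmulr_rle0// pmulr_rle0// innerDl !innerZl inner_norm.
have -> : c * `|t| ^+ 2 = delta by rewrite divfK// expf_neq0.
nra.
Qed.

(** Strong monotonicity contributes [beta1 |w - x|^2] to [delta], while [|w - q|^2 / (4 alpha)]
    removes at most [|w - x|^2 / (4 alpha)] up to terms in [|q - x|]. The shape is that of
    [cvg0_of_quadratic]. *)
Lemma forward_gap alpha beta1 beta2 C U x w q delta t d :
  0 < alpha -> cocoercive alpha C -> 0 < beta2 ->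
  strongly_monotone beta1 (single U) -> beta2.-lipschitz U ->
  t = U x - U w - C w + C q ->
  delta = '<x - w, t> - `|w - q| ^+ 2 / (4 * alpha) -> delta <= `|d| * `|t| ->
  (beta1 - 1 / (4 * alpha)) * `|w - x| ^+ 2 <=
    `|w - x| * (`|d| * (beta2 + alpha^-1) + `|q - x| * (3 / 2 * alpha^-1)) +
    `|q - x| * (`|d| * alpha^-1 + `|q - x| * (5 / 4 * alpha^-1)).
Proof.
move=> alpha0 coC b20 monU lipU tE dE dle; set a := `|w - x|; set e := `|q - x|.
have i0 : 0 < alpha^-1 by rewrite invr_gt0.
have -> : 1 / (4 * alpha) = alpha^-1 / 4 by field; rewrite gt_eqF.
pose v := C q - C w; pose g := `|w - q|.
have ga : g <= a + e.
  rewrite /g /e -[w - q](subrKA x) -(normrN (q - x)) opprB; exact: ler_normD.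
have v_le : `|v| <= alpha^-1 * g.
  by rewrite /g ler_pdivlMl// (distrC w); exact: cocoercive_lipschitz.
have U_mon : beta1 * a ^+ 2 <= '<x - w, U x - U w>.
  by have := monU (x, U x) (w, U w) erefl erefl; rewrite /a distrC.
have U_lip : `|U x - U w| <= beta2 * a.
  by rewrite /a (distrC w x); exact: (lipU (x, w)).
(* Passing from [x] to [q] makes the main part nonnegative by cocoercivity and leaves an error of
   order [|q - x|]. *)
have v_mon : - (e * `|v|) <= '<x - w, v>.
  have -> : '<x - w, v> = '<q - w, v> - '<q - x, v> by rewrite !innerE; ring.
  have := coC q w; have := cauchy_schwarz (q - x) v; rewrite -/v -/e ler_norml.
  by have := mulr_ge0 (ltW alpha0) (sqr_ge0 `|v|); lra.
have tE' : t = (U x - U w) + v by rewrite tE /v -addrA [- C w + _]addrC.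
have t_le : `|t| <= beta2 * a + alpha^-1 * g.
  by rewrite tE' (le_trans (ler_normD _ _))// lerD.
have := le_trans dle (ler_wpM2l (normr_ge0 d) t_le).
rewrite dE -/g tE' innerDr.
have -> : g ^+ 2 / (4 * alpha) = alpha^-1 / 4 * g ^+ 2 by field; rewrite gt_eqF.
have a0 : 0 <= a by exact: normr_ge0.
have e0 : 0 <= e by exact: normr_ge0.
have g0 : 0 <= g by exact: normr_ge0.
have d0 : 0 <= `|d| by exact: normr_ge0.
have : e * `|v| <= e * (alpha^-1 * g) by exact: ler_wpM2l.
have : e * (alpha^-1 * g) <= e * (alpha^-1 * (a + e)).
  by rewrite ler_wpM2l// ler_wpM2l// ltW.
have : `|d| * (alpha^-1 * g) <= `|d| * (alpha^-1 * (a + e)).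
  by rewrite ler_wpM2l// ler_wpM2l// ltW.
have : alpha^-1 * g ^+ 2 <= alpha^-1 * (a + e) ^+ 2.
  by rewrite ler_wpM2l ?(ltW i0)// ler_sqr ?nnegrE// addr_ge0.
lra.
Qed.

End Step.

(** * Convergence of the warped resolvent iteration *)

Theorem theorem4p14 (R : realType) (H : hilbertType R) (alpha : R)
    (W : H -> set H) (C : H -> H) (x0 : H) (lambda : nat -> R)
    (U : nat -> H -> H) (x w wstar q tstar d r : nat -> H) (delta : nat -> R)
    (alpha_gt0 : 0 < alpha)
    (W_max : maximally_monotone W)
    (C_coco : cocoercive alpha C)
    (Z_neq0 : zer (op_add W (single C)) !=set0)
    (lambda_01 : forall n, 0 < lambda n <= 1)
    (ran_U : forall n, ran (single (U n)) `<=`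
      ran (op_add (single (U n)) (op_add W (single C))))
    (inj_U : forall n,
      op_injective (op_add (single (U n)) (op_add W (single C))))
    (x_init : x 0%N = x0)
    (wE : forall n, w n = warped_resolvent (U n) (op_add W (single C)) (x n))
    (wstarE : forall n, wstar n = U n (x n) - U n (w n) - C (w n))
    (tstarE : forall n, tstar n = wstar n + C (q n))
    (deltaE : forall n,
      delta n = '<x n - w n, tstar n> - `|w n - q n| ^+ 2 / (4 * alpha))
    (dE : forall n, d n =
      if 0 < delta n then (delta n / `|tstar n| ^+ 2) *: tstar n else 0)
    (rE : forall n, r n = x n - lambda n *: d n)
    (xE : forall n, x n.+1 = Q x0 (x n) (r n)) :
  (\sum_(0 <= n <oo) (lambda n ^+ 2 * `|d n| ^+ 2)%:E < +oo)%E /\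
  (((\sum_(0 <= n <oo) (lambda n ^+ 2)%:E = +oo)%E /\
      cvgn (fun n => `|d n|) \/
    0 < inf (range lambda)) ->
   ([/\ weak_cvg (fun n => w n - x n) 0,
        (fun n => U n (w n) - U n (x n)) @ \oo --> (0 : H) &
        (fun n => w n - q n) @ \oo --> (0 : H)] \/
    ((fun n => q n - x n) @ \oo --> (0 : H) /\
     exists beta1 beta2 : R,
       [/\ 1 / (4 * alpha) < beta1, 0 < beta2,
           forall n, strongly_monotone beta1 (single (U n)) &
           forall n, beta2.-lipschitz (U n)])) ->
   x @ \oo --> proj_onto (zer (op_add W (single C))) x0).
Proof.
set Z := zer _ in Z_neq0 *.
have [z0 Zz0] := Z_neq0; have Wz0 : W z0 (- C z0) by exact: (zer_add_single W C z0).1 Zz0.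
have Ww n : W (w n) (wstar n).
  by rewrite wstarE wE; exact: warped_resolvent_mem.
have t0 n : tstar n = 0 -> delta n <= 0.
  move=> t0; rewrite deltaE t0 inner0r sub0r oppr_le0.
  by rewrite divr_ge0 ?sqr_ge0// mulr_ge0// ltW.
have Zr n : Z `<=` halfspace (x n) (r n).
  move=> z /(zer_add_single W C z).1 Wz; rewrite rE.
  apply: (step_halfspace (t0 n) (dE n) (lambda_01 n)); rewrite deltaE.
  have := zer_separation (q n) alpha_gt0 W_max.1 C_coco Wz (Ww n); rewrite -tstarE.
  have -> : '<z - x n, tstar n> = '<z - w n, tstar n> - '<x n - w n, tstar n>.
    by rewrite !innerE; ring.
  by lra.
have iter := haugazeau_iterates Z_neq0 x_init xE Zr.
have Zx n : Z `<=` halfspace x0 (x n) by case: (iter n).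
pose B := `|z0 - x0| ^+ 2.
have x_le n : `|x n - x0| ^+ 2 <= B.
  have := halfspace_sqdist (Zx n _ Zz0); rewrite (distrC x0) -/B.
  by have := sqr_ge0 `|z0 - x n|; lra.
have sum_le n : \sum_(0 <= i < n) lambda i ^+ 2 * `|d i| ^+ 2 <= B.
  apply: le_trans (x_le n); have [_] := iter n; apply: le_trans.
  rewrite le_eqVlt; apply/orP; left; apply/eqP/eq_bigr => i _.
  rewrite rE opprB addrC subrK normrZ exprMn ger0_norm//.
  by have /andP[/ltW] := lambda_01 i.
split.
  have := @nneseries_le _ (fun n => lambda n ^+ 2 * `|d n| ^+ 2) B.
  move=> h; apply: (@le_lt_trans _ _ B%:E); last exact: ltry.
  by apply: h => // n; rewrite mulr_ge0 ?sqr_ge0.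
move=> ab cd.
have d_cvg : `|d n| @[n --> \oo] --> (0 : R).
  case: ab => [ab|infl]; first by apply: (cvg0_of_weights _ sum_le).
  by apply: (cvg0_of_inf_weights _ infl sum_le) => n; have /andP[] := lambda_01 n.
have x_bnd n : `|x n| <= `|x0| + `|z0 - x0|.
  rewrite -{1}(subrK x0 (x n)) addrC (le_trans (ler_normD _ _))// lerD2l.
  by rewrite -ler_sqr ?nnegrE.
(* Both (c) and (d) are reduced to these limits. Under (d), [w n - x n] even vanishes strongly, and
   the Lipschitz bound carries this over to [U n]. *)
have [wx Uwx] : weak_cvg (fun n => w n - x n) 0 /\
    (fun n => U n (x n) - U n (w n)) @ \oo --> (0 : H).
  have flip (u v : nat -> H) : u n - v n @[n --> \oo] --> (0 : H) ->
      v n - u n @[n --> \oo] --> (0 : H).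
    move=> uv; rewrite -oppr0; under eq_fun do rewrite -opprB; exact: cvgN.
  case: cd => [[wx Uwx _]|[qx [b1 [b2 [b1_gt b2_gt U_mon U_lip]]]]].
    by split => //; exact: flip.
  have nqx : `|q n - x n| @[n --> \oo] --> (0 : R).
    by rewrite -(@normr0 _ H); exact: cvg_norm.
  have wx : w n - x n @[n --> \oo] --> (0 : H).
    apply: norm_cvg0; apply: (@cvg0_of_quadratic _ (b1 - 1 / (4 * alpha)) _
      (fun n => `|d n| * (b2 + alpha^-1) + `|q n - x n| * (3 / 2 * alpha^-1))
      (fun n => `|q n - x n| * (`|d n| * alpha^-1 + `|q n - x n| * (5 / 4 * alpha^-1)))).
    - by rewrite subr_gt0.
    - move=> n; apply: (forward_gap alpha_gt0 C_coco b2_gt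
        (U_mon n) (U_lip n) _ (deltaE n)).
        by rewrite tstarE wstarE.
      exact: step_norm (t0 n) (dE n).
    - by rewrite -[X in _ --> X]addr0; apply: cvgD;
        [rewrite -(mul0r (b2 + alpha^-1))|rewrite -(mul0r (3 / 2 * alpha^-1))]; exact: cvgMl.
    - rewrite -(mul0r 0); apply: cvgM => //; rewrite -[X in _ --> X]addr0; apply: cvgD;
        [rewrite -(mul0r alpha^-1)|rewrite -(mul0r (5 / 4 * alpha^-1))]; exact: cvgMl.
  split; first exact: cvg_weak.
  apply: norm_cvg0; apply: (squeeze_cvgr (f := cst 0) (h := fun n => b2 * `|w n - x n|)).
  - by apply: nearW => n; rewrite normr_ge0 distrC; exact: (U_lip n (w n, x n)).
  - exact: cvg_cst.
  - by rewrite -(mulr0 b2) -(@normr0 _ H); apply: cvgMr; exact: cvg_norm.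
have [M wM] : exists M, forall n, `|w n| <= M.
  have [M wxM] := weak_cvg_bounded wx.
  exists (M + (`|x0| + `|z0 - x0|)) => n.
  by rewrite -(subrK (x n) (w n)) (le_trans (ler_normD _ _))// lerD.
(* The residual is [e n = U n (x n) - U n (w n)], so that [wstar n = e n - C (w n)]. The point [p]
   passes from the tail hulls of [x] to those of [w]. *)
apply: haugazeau_cvg => // p xp; apply: (zer_add_single W C p).2.
apply: (zer_of_in_tail_hulls alpha_gt0 W_max C_coco Wz0 _ Uwx wM).
  by move=> n; rewrite -wstarE.
exact: in_tail_hulls_weak wx xp.
Qed.
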